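(* Let $m\ge 2$ and $n\ge m$ be integers, let $X_1,\ldots,X_n$ be i.i.d. random variables with values in a measurable space $\mathcal{X}$, and let $h:\mathcal{X}^m\to\mathbb{R}$ be measurable. Let $m_h=\mathrm{E}\,h(X_1,\ldots,X_m)$, let $U_n(h)$ be the U-statistic of order $m$ with kernel $h$, and let $k=\lfloor n/m\rfloor$. Suppose $Z=h(X_1,\ldots,X_m)$ is sub-Gaussian with variance proxy $\nu^2$, where $\nu>0$. Then for all $t>0$, $$P(|U_n(h)-m_h|\ge t)\le 2\exp\left(-\frac{kt^2}{2\nu^2}\right),$$ and for every $\delta\in(0,1)$, with probability at least $1-\delta$, $$|U_n(h)-m_h|\le\nu\sqrt{\frac{2\log(2/\delta)}{k}}.$$
   Context: The U-statistic of order $m$ with kernel $h$ based on $X_1,\ldots,X_n$ is $$U_n(h)=\frac{(n-m)!}{n!}\sum_{(i_1,\ldots,i_m)\in I_n^m}h(X_{i_1},\ldots,X_{i_m}),$$ where $I_n^m=\{(i_1,\ldots,i_m):1\le i_j\le n,\ i_j\ne i_l\text{ if }j\ne l\}$ is the set of all $m$-tuples of distinct integers between $1$ and $n$. The kernel $h$ is not assumed symmetric. A real random variable $Z$ with mean $\mu$ is sub-Gaussian with variance proxy $\nu^2$ if $\mathrm{E}\,e^{\lambda(Z-\mu)}\le e^{\lambda^2\nu^2/2}$ for all $\lambda\in\mathbb{R}$. *)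

(* Defs.v *)
(* MathComp-Analysis development. *)
From HB Require Import structures.
From mathcomp Require Import all_boot all_order all_algebra.
From mathcomp Require Import all_classical all_reals all_analysis.

Set Implicit Arguments.
Unset Strict Implicit.
Unset Printing Implicit Defensive.

Import Order.TTheory GRing.Theory Num.Theory.
Import numFieldNormedType.Exports.

Local Open Scope classical_set_scope.
Local Open Scope ring_scope.

Definition independent_RVs d d' (T : measurableType d) (S : measurableType d')
    (R : realType) (P : probability T R) (I : finType)
    (X : I -> {RV P >-> S}) : Prop :=
  forall (J : {set I}) (A : I -> set S),
    (forall i, i \in J -> measurable (A i)) ->
    P (\bigcap_(i in [set` J]) (X i @^-1` A i)) =
    (\prod_(i in J) P (X i @^-1` A i))%E.

Definition identically_distributed d d' (T : measurableType d)
    (S : measurableType d') (R : realType) (P : probability T R) (I : finType)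
    (X : I -> {RV P >-> S}) : Prop :=
  forall (i j : I) (A : set S), measurable A ->
    distribution P (X i) A = distribution P (X j) A.

Definition iid d d' (T : measurableType d) (S : measurableType d')
    (R : realType) (P : probability T R) (I : finType)
    (X : I -> {RV P >-> S}) : Prop :=
  independent_RVs X /\ identically_distributed X.

(* [v] is the variance proxy (the square, not its root). Integrability of [Z]
   is what makes "the mean of [Z]" meaningful: ['E_P[Z]] and [fine] are total. *)
Definition sub_gaussian d (T : measurableType d) (R : realType)
    (P : probability T R) (Z : T -> R) (v : R) : Prop :=
  P.-integrable [set: T] (EFin \o Z) /\
  forall lambda : R,
    ('M_P (fun w => Z w - fine 'E_P[Z])%R lambda
       <= (expR (lambda ^+ 2 * v / 2)%R)%:E)%E.

(* The duplicate-free tuples [i : m.-tuple 'I_n] are the m-tuples of distinct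
   indices, shifted to range over 0, ..., n - 1. *)
Definition U_statistic (R : realType) (S : Type) (m n : nat)
    (h : m.-tuple S -> R) (x : 'I_n -> S) : R :=
  (n - m)`!%:R / n`!%:R *
  \sum_(i : m.-tuple 'I_n | uniq i) h [tuple x (tnth i j) | j < m].

(* Main.v *)
Require Import Defs.
From HB Require Import structures.
From mathcomp Require Import all_boot all_order all_algebra.
From mathcomp Require Import fingroup perm action primitive_action alt ring.
From mathcomp Require Import all_classical all_reals all_analysis.
From mathcomp Require Import measurable_realfun.

(** The terms of a U-statistic are dependent, but the statistic is an average of
    averages of independent terms (Hoeffding). For a permutation p of the n
    indices, cut the first k * m of the permuted variables into k consecutive
    blocks of length m, and average h over these blocks. Averaging the result
    over all p gives back the U-statistic (U_statistic_perm_block_mean): each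
    block, read through a uniformly chosen permutation, is a uniformly chosen
    duplicate-free m-tuple of indices.

    The exponential is convex, so the moment generating function of U - c at l is
    at most the mean over p of those of the block averages. For a fixed p the
    blocks involve disjoint sets of variables, so the k terms are independent
    with the law of Z. The moment generating function at l of their average
    minus c is thus the k-th power of that of Z - c at l / k
    (U_statistic_mgf_le). With
    c the mean of Z, the sub-Gaussian hypothesis bounds this power by
    expR ((l / k) ^+ 2 * nu ^+ 2 / 2) ^+ k = expR (l ^+ 2 * (nu ^+ 2 / k) / 2).
    Chernoff's bound on both sides (sub_gaussian_tail) gives the deviation
    inequality, and the confidence bound is the same inequality solved for t.

    Independence is given by probabilities of rectangles only. Rectangles
    determine the law of a tuple of variables (tuple_measure_unique), so the law
    of a concatenation of two groups of independent variables is a product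
    measure, and expectations of products factor by Tonelli's theorem
    (expectation_joint_cat), then by induction over the blocks
    (expectation_blocks). *)

Import Order.TTheory GRing.Theory Num.Theory.
Import numFieldNormedType.Exports.

Local Open Scope classical_set_scope.
Local Open Scope ring_scope.

Set Implicit Arguments.
Unset Strict Implicit.

(** * Laws of independent families *)

Definition box (S : Type) (p : nat) (A : 'I_p -> set S) : set (p.-tuple S) :=
  [set y | forall j, A j (tnth y j)].

Lemma measurable_box d (S : measurableType d) (p : nat) (A : 'I_p -> set S) :
  (forall j, measurable (A j)) -> measurable (box A).
Proof.
move=> mA.
have -> : box A = \bigcap_(j in [set: 'I_p]) ((@tnth p S ^~ j) @^-1` A j).
  by apply/seteqP; split=> y /= h j; [move=> _; exact: h|exact: h j I].
apply: fin_bigcap_measurable => // j _.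
by rewrite -[X in measurable X]setTI; exact: measurable_tnth.
Qed.

(** Boxes are stable under intersection and generate the product sigma-algebra,
    so this is the pi-lambda uniqueness theorem for finite measures. *)
Lemma tuple_measure_unique d (S : measurableType d) (R : realType) (p : nat)
    (mu1 mu2 : {measure set (p.-tuple S) -> \bar R}) :
  (mu1 [set: p.-tuple S] < +oo)%E ->
  (forall A : 'I_p -> set S, (forall j, measurable (A j)) ->
    mu1 (box A) = mu2 (box A)) ->
  forall B, measurable B -> mu1 B = mu2 B.
Proof.
move=> fin12 eq12.
pose G : set (set (p.-tuple S)) :=
  [set box A | A in [set A | forall j, measurable (A j)]].
have boxT : box (fun _ : 'I_p => [set: S]) = setT.
  by apply/seteqP; split.
have GT : G setT by exists (fun=> setT).
apply: (measure_unique G (fun=> setT)) => //.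
- apply/seteqP; split; last first.
    apply: smallest_sub; first exact: sigma_algebra_measurable.
    by move=> _ [A mA <-]; exact: measurable_box.
  apply: sub_sigma_algebra2 => B.
  rewrite -bigcup_seq/= => -[j _ [C mC <-]].
  (* a cylinder is a box with full sides except at j *)
  exists (fun i => if i == j then C else setT) => [i|]; first by case: ifP.
  apply/seteqP; split => y /=.
    by move=> /(_ j); rewrite eqxx.
  by move=> [_ Cy] i; case: eqP => // ->.
- move=> _ _ [A mA <-] [B mB <-].
  exists (fun j => A j `&` B j) => [j|]; first exact: measurableI.
  by apply/seteqP; split => y /= => [h|[h1 h2] j]; [split=> j; case: (h j)|split].
- by rewrite bigcup_const.
- by move=> A [C mC <-]; exact: eq12.
Qed.

Lemma block_index_subproof k m (b : 'I_k) (j : 'I_m) : (b * m + j < k * m)%N.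
Proof.
apply: (@leq_trans (b.+1 * m)); last by rewrite leq_mul2r ltn_ord orbT.
by rewrite mulSnr ltn_add2l.
Qed.

(** Position j of the b-th of k consecutive blocks of length m. *)
Definition block_index k m (b : 'I_k) (j : 'I_m) : 'I_(k * m) :=
  Ordinal (block_index_subproof b j).

Lemma block_index_inj k m (b : 'I_k) : injective (@block_index k m b).
Proof. by move=> i j [] /addnI /val_inj. Qed.

Definition joint (S T : Type) (p : nat) (X : 'I_p -> T -> S) (w : T) :
  p.-tuple S := [tuple X j w | j < p].

Section joint_law.
Context d d' (T : measurableType d) (S : measurableType d') (R : realType)
  (P : probability T R).

Section joint_rv.
Variables (p : nat) (X : 'I_p -> {RV P >-> S}).

Lemma measurable_joint : measurable_fun setT (joint X).
Proof.
apply/measurable_fun_tnthP => j.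
rewrite [Z in measurable_fun _ Z](_ : _ = (X j : T -> S)) //.
by apply/funext => w; rewrite /= tnth_mktuple.
Qed.

HB.instance Definition _ := isMeasurableFun.Build _ _ _ _ (joint X)
  measurable_joint.

Lemma independent_box (A : 'I_p -> set S) :
  independent_RVs X -> (forall j, measurable (A j)) ->
  P (joint X @^-1` box A) = (\prod_(j < p) P (X j @^-1` A j))%E.
Proof.
move=> iX mA.
have := iX [set: 'I_p]%SET A (fun i _ => mA i).
rewrite (eq_bigl predT); last by move=> j; rewrite inE.
move=> <-; congr (P _).
apply/seteqP; split => w /= => [h j _|h j].
  by have := h j; rewrite tnth_mktuple.
by rewrite tnth_mktuple; apply: h; rewrite /= inE.
Qed.

End joint_rv.

(** On boxes both laws are the product of the marginal laws. *)
Lemma joint_law_eq p (X Y : 'I_p -> {RV P >-> S}) :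
  independent_RVs X -> independent_RVs Y ->
  (forall j A, measurable A -> P (X j @^-1` A) = P (Y j @^-1` A)) ->
  forall B, measurable B -> P (joint X @^-1` B) = P (joint Y @^-1` B).
Proof.
move=> iX iY XY B mB.
apply: (@tuple_measure_unique _ _ _ _ (distribution P (joint X))
  (distribution P (joint Y))) => //.
  by rewrite (le_lt_trans (probability_le1 (distribution P (joint X)) _)) ?ltry.
move=> A mA; rewrite /distribution/= /pushforward.
etransitivity; first exact: independent_box.
rewrite (eq_bigr (fun j => P (Y j @^-1` A j))); last by move=> j _; exact: XY.
by apply/esym; exact: independent_box.
Qed.

Lemma independent_reindex (I J : finType) (X : I -> {RV P >-> S})
    (g : J -> I) : injective g ->
  independent_RVs X -> independent_RVs (fun j => X (g j)).
Proof.
move=> g_inj iX K A mA.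
(* B transports A along g, with full sides outside the image of g *)
pose B i := [set s | forall j, g j = i -> A j s].
have Bg j : B (g j) = A j.
  apply/seteqP; split => s /= => [|As j' /g_inj ->//].
  exact.
have := iX (g @: K)%SET B.
rewrite big_imset/=; last by move=> ? ? _ _; exact: g_inj.
under eq_bigr do rewrite Bg.
move=> <-; last by move=> _ /imsetP[j jK ->]; rewrite Bg; exact: mA.
congr (P _); apply/seteqP; split => w /= h.
  by move=> i /imsetP[j jK ->] /=; rewrite Bg; exact: h.
by move=> j jK; have := h (g j) (imset_f _ jK); rewrite /= Bg.
Qed.

Definition cat_pair p q (y : p.-tuple S * q.-tuple S) : (p + q).-tuple S :=
  [tuple of y.1 ++ y.2].

Lemma measurable_cat_pair p q : measurable_fun setT (@cat_pair p q).
Proof.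
apply/measurable_fun_tnthP => j; case: (split_ordP j) => i ->.
  rewrite [Z in measurable_fun _ Z](_ : _ = @tnth p S ^~ i \o fst).
    by apply: measurableT_comp => //; exact: measurable_tnth.
  by apply/funext => -[a b]; rewrite /= tnth_lshift.
rewrite [Z in measurable_fun _ Z](_ : _ = @tnth q S ^~ i \o snd).
  by apply: measurableT_comp => //; exact: measurable_tnth.
by apply/funext => -[a b]; rewrite /= tnth_rshift.
Qed.

HB.instance Definition _ p q := isMeasurableFun.Build _ _ _ _ (@cat_pair p q)
  (@measurable_cat_pair p q).

(** On boxes, the law of the whole family is the image under concatenation of
    the product of the laws of its two halves. Hence the two measures coincide
    and the identity is an instance of Tonelli's theorem. *)
Lemma expectation_joint_cat p q (X : 'I_(p + q) -> {RV P >-> S})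
    (F : p.-tuple S -> \bar R) (G : q.-tuple S -> \bar R) :
  independent_RVs X ->
  measurable_fun [set: p.-tuple S] F -> (forall y, 0 <= F y)%E ->
  measurable_fun [set: q.-tuple S] G -> (forall y, 0 <= G y)%E ->
  (\int[P]_w (F (joint (fun j => X (lshift q j)) w) *
              G (joint (fun j => X (rshift p j)) w)) =
   (\int[P]_w F (joint (fun j => X (lshift q j)) w)) *
   (\int[P]_w G (joint (fun j => X (rshift p j)) w)))%E.
Proof.
move=> iX mF F0 mG G0.
pose Xl := fun j => X (lshift q j); pose Xr := fun j => X (rshift p j).
have iXl : independent_RVs Xl by apply: independent_reindex iX; exact: lshift_inj.
have iXr : independent_RVs Xr by apply: independent_reindex iX; exact: rshift_inj.
pose H (y : p.-tuple S * q.-tuple S) := (F y.1 * G y.2)%E.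
have mH : measurable_fun setT H.
  by apply: emeasurable_funM; exact: measurableT_comp.
have H0 y : (0 <= H y)%E by exact: mule_ge0.
pose split_tuple (y : (p + q).-tuple S) : p.-tuple S * q.-tuple S :=
  ([tuple tnth y (lshift q j) | j < p], [tuple tnth y (rshift p j) | j < q]).
have msplit : measurable_fun setT split_tuple.
  apply: measurable_fun_pair; apply/measurable_fun_tnthP => j;
    rewrite /comp; under eq_fun do rewrite tnth_mktuple;
    exact: measurable_tnth.
have splitK y : split_tuple (cat_pair y) = y.
  case: y => a b; congr (_, _); apply: eq_from_tnth => j; rewrite tnth_mktuple.
    by rewrite tnth_lshift.
  by rewrite tnth_rshift.
have splitX w : split_tuple (joint X w) = (joint Xl w, joint Xr w).
  by congr (_, _); apply: eq_from_tnth => j; rewrite !tnth_mktuple.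
have mHs : measurable_fun setT (H \o split_tuple) by exact: measurableT_comp.
have lawX B : measurable B -> distribution P (joint X) B =
    pushforward (distribution P (joint Xl) \x distribution P (joint Xr))%E
      (@cat_pair p q) B.
  move=> mB.
  apply: tuple_measure_unique => //=.
    by rewrite (le_lt_trans (probability_le1 (distribution P (joint X)) _)) ?ltry.
  move=> A mA; rewrite [RHS]/pushforward.
  transitivity (P (joint X @^-1` box A)); first by [].
  etransitivity; first exact: independent_box.
  have -> : @cat_pair p q @^-1` box A =
      box (fun j => A (lshift q j)) `*` box (fun j => A (rshift p j)).
    apply/seteqP; split => -[a b] /=.
      move=> h; split=> j.
        by have := h (lshift q j); rewrite tnth_lshift.
      by have := h (rshift p j); rewrite tnth_rshift.
    move=> [ha hb] j; case: (split_ordP j) => i ->.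
      by rewrite tnth_lshift; exact: ha.
    by rewrite tnth_rshift; exact: hb.
  apply/esym; etransitivity.
    by apply: product_measure1E; exact: measurable_box.
  rewrite big_split_ord/=.
  congr (_ * _)%E.
    exact: (independent_box (X := Xl) (A := fun j => A (lshift q j)) iXl).
  exact: (independent_box (X := Xr) (A := fun j => A (rshift p j)) iXr).
transitivity (\int[P]_w ((H \o split_tuple) \o joint X) w)%E.
  by apply: eq_integral => w _; rewrite /= splitX.
rewrite -ge0_integral_distribution//; last by move=> y; exact: H0.
rewrite (eq_measure_integral (pushforward
  (distribution P (joint Xl) \x distribution P (joint Xr))%E (@cat_pair p q)));
  last by move=> B mB _; exact: lawX.
rewrite ge0_integral_pushforward//; last first.
  by move=> y _; exact: H0.
rewrite preimage_setT.
under eq_integral do rewrite /= splitK.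
rewrite fubini_tonelli1//= /fubini_F /H /=.
under eq_integral do rewrite ge0_integralZl//.
rewrite ge0_integralZr//; last by exact: integral_ge0.
by rewrite !ge0_integral_distribution.
Qed.

(** Blocks of distinct variables are independent: the first block splits off
    from the remaining k * m variables, and induction handles these. *)
Lemma expectation_blocks k m (X : 'I_(k * m) -> {RV P >-> S})
    (f : m.-tuple S -> R) :
  independent_RVs X ->
  measurable_fun [set: m.-tuple S] f -> (forall y, 0 <= f y) ->
  (\int[P]_w (\prod_(b < k) f (joint (fun j => X (block_index b j)) w))%:E =
   \prod_(b < k)
     \int[P]_w (f (joint (fun j => X (block_index b j)) w))%:E)%E.
Proof.
move=> + mf f0; elim: k X => [|k IH] X iX.
  rewrite big_ord0; under eq_integral do rewrite big_ord0.
  by rewrite integral_cst// mul1e; exact: probability_setT.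
(* X itself, its index type 'I_(k.+1 * m) being convertible to a sum *)
pose Xs : 'I_(m + k * m) -> {RV P >-> S} := X.
pose Xr (i : 'I_(k * m)) : {RV P >-> S} := Xs (rshift m i).
have iXr : independent_RVs Xr.
  by apply: (independent_reindex (X := Xs)) iX; exact: rshift_inj.
have X0 w : joint (fun j : 'I_m => X (block_index (@ord0 k) j)) w =
    joint (fun j => Xs (lshift (k * m) j)) w.
  apply: eq_from_tnth => j; rewrite !tnth_mktuple.
  by congr (X _ w); exact: val_inj.
have Xlift b w : joint (fun j : 'I_m => X (block_index (lift (@ord0 k) b) j)) w =
    joint (fun j => Xr (block_index b j)) w.
  apply: eq_from_tnth => j; rewrite !tnth_mktuple.
  by congr (X _ w); apply: val_inj; rewrite /= /bump/= mulSn addnA.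
pose G (y : (k * m).-tuple S) :=
  \prod_(b < k) f [tuple tnth y (block_index b j) | j < m].
have mG : measurable_fun [set: (k * m).-tuple S] G.
  apply: measurable_prod => b _; apply: measurableT_comp => //.
  apply/measurable_fun_tnthP => j; rewrite /comp.
  by under eq_fun do rewrite tnth_mktuple; exact: measurable_tnth.
have GX w : G (joint Xr w) =
    \prod_(b < k) f (joint (fun j => Xr (block_index b j)) w).
  apply: eq_bigr => b _; congr f.
  by apply: eq_from_tnth => j; rewrite !tnth_mktuple.
rewrite big_ord_recl; under [in RHS]eq_integral do rewrite X0.
under [in RHS]eq_bigr do under eq_integral do rewrite Xlift.
rewrite -(IH Xr iXr).
transitivity (\int[P]_w ((f (joint (fun j => Xs (lshift (k * m) j)) w))%:E *
                         (G (joint Xr w))%:E))%E.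
  apply: eq_integral => w _; rewrite big_ord_recl X0 GX EFinM.
  by under eq_bigr do rewrite Xlift.
have -> : (\int[P]_w (\prod_(b < k)
      f (joint (fun j => Xr (block_index b j)) w))%:E =
    \int[P]_w (G (joint Xr w))%:E)%E.
  by apply: eq_integral => w _; rewrite GX.
apply: (expectation_joint_cat (F := EFin \o f) (G := EFin \o G) (X := Xs)) => //.
- exact/measurable_EFinP.
- exact/measurable_EFinP.
- by move=> y; rewrite /= lee_fin; exact: prodr_ge0.
Qed.

(** For i.i.d. variables each block has the law of any m distinct variables,
    so all the factors are equal. *)
Lemma expectation_iid_blocks k m n (X : 'I_n -> {RV P >-> S})
    (g : 'I_(k * m) -> 'I_n) (g' : 'I_m -> 'I_n) (f : m.-tuple S -> R) :
  iid X -> injective g -> injective g' ->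
  measurable_fun [set: m.-tuple S] f -> (forall y, 0 <= f y) ->
  (\int[P]_w (\prod_(b < k) f (joint (fun j => X (g (block_index b j))) w))%:E =
   (\int[P]_w (f (joint (fun j => X (g' j)) w))%:E) ^+ k)%E.
Proof.
move=> [iX dX] g_inj g'_inj mf f0.
have iXg : independent_RVs (fun i => X (g i)) by exact: independent_reindex iX.
rewrite (expectation_blocks (X := fun i => X (g i)))//.
transitivity (\prod_(b < k)
    \int[P]_w (f (joint (fun j => X (g' j)) w))%:E)%E; last first.
  by rewrite big_const_ord; elim: (k) => // l IHl; rewrite iterS IHl expeS.
apply: eq_bigr => b _.
have law B : measurable B ->
    distribution P (joint (fun j => X (g (block_index b j)))) B =
    distribution P (joint (fun j => X (g' j))) B.
  apply: joint_law_eq.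
  - by apply: independent_reindex iXg; exact: block_index_inj.
  - exact: independent_reindex iX.
  - by move=> j A mA; exact: dX.
transitivity (\int[distribution P (joint (fun j => X (g (block_index b j))))]_y
  (f y)%:E)%E.
  by rewrite ge0_integral_distribution//; exact/measurable_EFinP.
rewrite (eq_measure_integral (distribution P (joint (fun j => X (g' j)))));
  last by move=> B mB _; exact: law.
by rewrite ge0_integral_distribution//; exact/measurable_EFinP.
Qed.

End joint_law.

(** * Averaging over permutations *)

(** The symmetric group acts transitively on duplicate-free tuples. *)
Lemma uniq_tuple_transport n m (s t : m.-tuple 'I_n) : uniq s -> uniq t ->
  exists p : {perm 'I_n}, forall j, tnth t j = p (tnth s j).
Proof.
move=> us ut.
have in_dt (v : m.-tuple 'I_n) : uniq v -> v \in (m.-dtuple([set: 'I_n]%SET)).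
  by move=> uv; rewrite inE uv; apply/fintype.subsetP => i _; rewrite inE.
have m_le : (m <= #|'I_n|)%N.
  by rewrite -(card_uniq_tuple us); exact: max_card.
have tr := ntransitive_weak m_le (Sym_trans 'I_n).
have := in_dt t ut; rewrite -(atransP tr _ (in_dt s us)) => /imsetP[p _ ->].
by exists p => j; rewrite tnth_map.
Qed.

Section permutation_average.
Context (R : realType) (S : Type) (m n : nat).
Variables (h : m.-tuple S -> R) (x : 'I_n -> S).

Lemma U_statisticE :
  (m <= n)%N -> U_statistic h x =
  #|[set t : m.-tuple 'I_n | uniq t]%SET|%:R^-1 *
    \sum_(t : m.-tuple 'I_n | uniq t) h [tuple x (tnth t j) | j < m].
Proof.
move=> mn; rewrite /U_statistic; congr (_ * _).
have := card_uniq_tuples m (predT : pred 'I_n).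
rewrite card_ord => cE.
have -> : #|[set t : m.-tuple 'I_n | uniq t]%SET| = (n ^_ m)%N.
  rewrite -cE; apply: eq_card => t; rewrite !inE.
  by rewrite (_ : all _ t) //; apply/allP.
rewrite -(ffact_fact mn) natrM invfM mulrC mulrVK//.
by rewrite unitfE pnatr_eq0 -lt0n fact_gt0.
Qed.

(** By transitivity the sum does not depend on t, so it may be averaged over
    all duplicate-free tuples. For each fixed p this average is the U-statistic,
    since p permutes these tuples. *)
Lemma sum_perm_uniq_tuple (t : m.-tuple 'I_n) : uniq t ->
  \sum_(p : {perm 'I_n}) h [tuple x (p (tnth t j)) | j < m] =
  n`!%:R * U_statistic h x.
Proof.
move=> ut.
have mn : (m <= n)%N.
  by rewrite -(card_uniq_tuple ut) -[leqRHS]card_ord; exact: max_card.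
set D := [set s : m.-tuple 'I_n | uniq s]%SET.
have D0 : (#|D|%:R : R) != 0.
  by rewrite pnatr_eq0 -lt0n; apply/card_gt0P; exists t; rewrite inE.
pose orb (s : m.-tuple 'I_n) :=
  \sum_(p : {perm 'I_n}) h [tuple x (p (tnth s j)) | j < m].
have orb_cst (s : m.-tuple 'I_n) : uniq s -> orb s = orb t.
  move=> us; have [q qE] := uniq_tuple_transport us ut.
  rewrite /orb (reindex_inj (mulgI q))/=; apply: eq_bigr => p _.
  by congr h; apply: eq_from_tnth => j; rewrite !tnth_mktuple qE permM.
have perm_sum (p : {perm 'I_n}) :
    \sum_(s : m.-tuple 'I_n | uniq s)
      h [tuple x (p (tnth (s : m.-tuple 'I_n) j)) | j < m] =
    #|D|%:R * U_statistic h x.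
  rewrite U_statisticE// mulVKf//.
  have inj : injective (map_tuple p : m.-tuple 'I_n -> _).
    move=> s s' /(congr1 val) /= /inj_map e; apply: val_inj; apply: e.
    exact: perm_inj.
  rewrite [RHS](reindex_inj inj)/=.
  apply: eq_big => [s|s _]; first by rewrite map_inj_uniq//; exact: perm_inj.
  by congr h; apply: eq_from_tnth => j; rewrite !tnth_mktuple tnth_map.
apply: (mulfI D0); rewrite -/(orb t) mulrCA.
transitivity (\sum_(s : m.-tuple 'I_n | uniq s) orb s).
  rewrite (eq_bigr (fun=> orb t)) => [|s us]; last exact: orb_cst.
  rewrite sumr_const mulr_natl; congr (_ *+ _).
  by apply: eq_card => s; rewrite inE.
rewrite exchange_big/= (eq_bigr _ (fun p _ => perm_sum p)) sumr_const.
by rewrite card_Sn -[in LHS](mulr_natl _ n`!).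
Qed.

(** Hoeffding's decomposition: for each permutation the inner mean involves k
    disjoint blocks of the variables, hence k independent terms. *)
Lemma U_statistic_perm_block_mean k (km_le : (k * m <= n)%N) :
  (0 < k)%N ->
  U_statistic h x = n`!%:R^-1 * \sum_(p : {perm 'I_n}) k%:R^-1 *
    \sum_(b < k) h [tuple x (p (widen_ord km_le (block_index b j))) | j < m].
Proof.
move=> k_gt0.
have k_neq0 : k%:R != 0 :> R by rewrite pnatr_eq0 -lt0n.
have n_neq0 : n`!%:R != 0 :> R by rewrite pnatr_eq0 -lt0n fact_gt0.
rewrite -mulr_sumr exchange_big/= (eq_bigr (fun=> n`!%:R * U_statistic h x)).
  rewrite sumr_const card_ord -(mulr_natl (n`!%:R * _) k) (mulKf k_neq0).
  by rewrite mulKf.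
move=> b _; pose t := [tuple widen_ord km_le (block_index b j) | j < m].
rewrite -(@sum_perm_uniq_tuple t).
  apply: eq_bigr => p _; congr h; apply: eq_from_tnth => j.
  by rewrite !tnth_mktuple.
rewrite map_inj_uniq ?enum_uniq// => i j /(congr1 val)/= /addnI.
exact: val_inj.
Qed.

End permutation_average.

(** * Moment generating functions and tails *)

(** Jensen's inequality for the exponential, by summing over i the tangent line
    inequality at the mean c. *)
Lemma expR_mean_le (R : realType) (I : finType) (x : I -> R) : (0 < #|I|)%N ->
  expR (#|I|%:R^-1 * \sum_i x i) <= #|I|%:R^-1 * \sum_i expR (x i).
Proof.
move=> I_gt0; set c := _ * \sum_i x i.
have N_gt0 : 0 < #|I|%:R :> R by rewrite ltr0n.
rewrite ler_pdivlMl//.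
apply: (@le_trans _ _ (\sum_i expR c * (1 + (x i - c)))); last first.
  apply: ler_sum => i _.
  rewrite -{2}(subrK c (x i)) [in leRHS]addrC expRD ler_pM2l ?expR_gt0//.
  exact: expR_ge1Dx.
rewrite -mulr_sumr big_split/= sumrB !sumr_const -[c *+ _]mulr_natl.
have -> : #|I|%:R * c = \sum_i x i by rewrite mulVKf ?gt_eqF.
by rewrite subrr addr0 mulrC.
Qed.

Section deviation.
Context d d' (T : measurableType d) (S : measurableType d') (R : realType)
  (P : probability T R).

(** Chernoff's bound at the optimal parameter t / v, applied to Y and to - Y. *)
Lemma sub_gaussian_tail (Y : T -> R) (v t : R) :
  measurable_fun setT Y -> 0 < v -> 0 < t ->
  (forall l, 'M_P Y l <= (expR (l ^+ 2 * v / 2))%:E)%E ->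
  (P [set w | t <= `|Y w|]%R <= (2 * expR (- (t ^+ 2 / (2 * v))))%:E)%E.
Proof.
move=> mY v_gt0 t_gt0 mgf.
have one_sided (Z : T -> R) : measurable_fun setT Z ->
    (forall l, 'M_P Z l <= (expR (l ^+ 2 * v / 2))%:E)%E ->
    (P [set w | t <= Z w]%R <= (expR (- (t ^+ 2 / (2 * v))))%:E)%E.
  move=> mZ mgfZ.
  pose Z' : {RV P >-> R} := HB.pack Z (isMeasurableFun.Build _ _ _ _ _ mZ).
  have tv_gt0 : 0 < t / v by exact: divr_gt0.
  apply: (le_trans (chernoff Z' t tv_gt0)).
  apply: (le_trans (lee_wpmul2r _ (mgfZ (t / v)))).
    by rewrite lee_fin expR_ge0.
  rewrite -EFinM lee_fin -expRD ler_expR le_eqVlt; apply/orP; left.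
  by apply/eqP; field; rewrite gt_eqF.
have mge (Z : T -> R) : measurable_fun setT Z -> measurable [set w | t <= Z w].
  move=> mZ; rewrite -[X in measurable X]setTI.
  have -> : [set w | t <= Z w] = Z @^-1` `[t, +oo[.
    by apply/seteqP; split => w /=; rewrite in_itv/= andbT.
  exact: mZ.
have mNY : measurable_fun setT (fun w => - Y w) by exact: measurableT_comp.
have -> : [set w | t <= `|Y w|] = [set w | t <= Y w] `|` [set w | t <= - Y w].
  by apply/seteqP; split => w /=; rewrite ler_normr; [move/orP|move=> ?; apply/orP].
apply: (le_trans (measureU2 _ (mge _ mY) (mge _ mNY))).
rewrite mulr_natl mulr2n EFinD; apply: leeD; apply: one_sided => // l.
have := mgf (- l); rewrite sqrrN; apply: le_trans.
rewrite /mmt_gen_fun le_eqVlt; apply/orP; left; apply/eqP; congr ('E_P[_])%E.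
by apply/funext => w /=; rewrite mulrN mulNr.
Qed.

Lemma measurable_U_statistic m n (X : 'I_n -> {RV P >-> S})
    (h : m.-tuple S -> R) :
  measurable_fun [set: m.-tuple S] h ->
  measurable_fun setT (fun w => U_statistic h (fun i => X i w)).
Proof.
move=> mh; apply: measurable_funM => //; under eq_fun do rewrite -big_filter.
apply: measurable_sum => t; apply: measurableT_comp => //.
exact: (measurable_joint (fun j => X (tnth t j))).
Qed.

(** Jensen's inequality bounds the exponential of the U-statistic by the mean
    over permutations of products over disjoint blocks. The expectation of each
    product is the k-th power on the right, whatever the permutation. *)
Lemma U_statistic_mgf_le m n k (X : 'I_n -> {RV P >-> S}) (h : m.-tuple S -> R)
    (g : 'I_m -> 'I_n) (c l : R) :
  iid X -> injective g -> measurable_fun [set: m.-tuple S] h ->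
  (0 < k)%N -> (k * m <= n)%N ->
  ('M_P (fun w => U_statistic h (fun i => X i w) - c)%R l <=
   'M_P (fun w => h [tuple X (g j) w | j < m] - c)%R (l / k%:R) ^+ k)%E.
Proof.
move=> iidX g_inj mh k_gt0 km_le.
have k_neq0 : k%:R != 0 :> R by rewrite pnatr_eq0 -lt0n.
pose f y := expR ((h y - c) * (l / k%:R)).
have mf : measurable_fun [set: m.-tuple S] f.
  apply: measurableT_comp => //; apply: measurable_funM => //.
  exact: measurable_funB.
have f_ge0 y : 0 <= f y by exact: expR_ge0.
pose blk (p : {perm 'I_n}) (b : 'I_k) :=
  joint (fun j : 'I_m => X (p (widen_ord km_le (block_index b j)))).
have perm_gt0 : (0 < #|{perm 'I_n}|)%N by rewrite card_Sn fact_gt0.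
have N_neq0 : #|{perm 'I_n}|%:R != 0 :> R by rewrite pnatr_eq0 -lt0n.
have jensen w : expR ((U_statistic h (fun i => X i w) - c) * l) <=
    n`!%:R^-1 * \sum_(p : {perm 'I_n}) \prod_(b < k) f (blk p b w).
  rewrite -card_Sn (eq_bigr (fun p : {perm 'I_n} =>
    expR (k%:R^-1 * \sum_(b < k) (h (blk p b w) - c) * l))); last first.
    move=> p _; rewrite -expR_sum; congr expR; rewrite mulr_sumr.
    by apply: eq_bigr => b _; rewrite mulrA mulrC.
  apply: le_trans _ (expR_mean_le _ perm_gt0); rewrite ler_expR.
  rewrite le_eqVlt; apply/orP; left; apply/eqP.
  have inner (p : {perm 'I_n}) :
      k%:R^-1 * \sum_(b < k) (h (blk p b w) - c) * l =
      (k%:R^-1 * \sum_(b < k) h (blk p b w) - c) * l.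
    rewrite -mulr_suml sumrB sumr_const card_ord mulrA mulrBr.
    by rewrite -(mulr_natl c k) (mulKf k_neq0).
  rewrite (eq_bigr _ (fun p _ => inner p)) -mulr_suml sumrB sumr_const.
  rewrite mulrA mulrBr -(mulr_natl c #|{perm 'I_n}|) (mulKf N_neq0).
  by rewrite (U_statistic_perm_block_mean _ _ km_le)// card_Sn.
have mblk p b : measurable_fun setT (blk p b) by exact: measurable_joint.
have mprod p : measurable_fun setT (fun w => \prod_(b < k) f (blk p b w)).
  by apply: measurable_prod => b _; exact: measurableT_comp.
have mU := measurable_U_statistic X mh.
pose M := ('M_P (fun w => h [tuple X (g j) w | j < m] - c)%R (l / k%:R))%E.
rewrite -/M.
have ME p : (\int[P]_w (\prod_(b < k) f (blk p b w))%:E = M ^+ k)%E.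
  rewrite /M /mmt_gen_fun expectation.unlock.
  have p_inj : injective (fun i : 'I_(k * m) => p (widen_ord km_le i)).
    by move=> i j /perm_inj/(congr1 val)/= ?; exact: val_inj.
  exact: (expectation_iid_blocks iidX p_inj g_inj mf f_ge0).
rewrite {1}/mmt_gen_fun expectation.unlock.
apply: (@le_trans _ _ (\int[P]_w
  (n`!%:R^-1 * \sum_(p : {perm 'I_n}) \prod_(b < k) f (blk p b w))%:E)%E).
  apply: ge0_le_integral => //.
  - by move=> w _; rewrite lee_fin expR_ge0.
  - apply/measurable_EFinP; apply: measurableT_comp => //.
    by apply: measurable_funM => //; exact: measurable_funB.
  - apply/measurable_EFinP; apply: measurable_funM => //.
    by apply: measurable_sum => p; exact: mprod.
  - by move=> w _; rewrite lee_fin; exact: jensen.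
under eq_integral do rewrite EFinM -sumEFin.
rewrite ge0_integralZl//; last 2 first.
- by apply: emeasurable_sum => p; exact/measurable_EFinP.
- by move=> w _; apply: sume_ge0 => p _; rewrite lee_fin prodr_ge0.
rewrite ge0_integral_sum//; last 2 first.
- by move=> p; exact/measurable_EFinP.
- by move=> p w _; rewrite lee_fin prodr_ge0.
have -> : (\sum_(p : {perm 'I_n}) \int[P]_w (\prod_(b < k) f (blk p b w))%:E =
    #|{perm 'I_n}|%:R%:E * M ^+ k)%E.
  by rewrite (eq_bigr _ (fun p _ => ME p)) sumr_const mule_natl.
rewrite muleA -EFinM.
by rewrite -card_Sn mulVf// mul1e.
Qed.

End deviation.

Lemma lee_expe (R : realDomainType) (x y : \bar R) (k : nat) :
  (0 <= x)%E -> (x <= y)%E -> (x ^+ k <= y ^+ k)%E.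
Proof.
move=> x_ge0 xy; elim: k => [|k IH]; first by rewrite !expe0.
by rewrite !expeS lee_pmul// expe_ge0.
Qed.

Theorem theorem4p2 (R : realType) (d d' : measure_display)
    (T : measurableType d) (S : measurableType d') (P : probability T R)
    (m n : nat) (m_ge2 : (2 <= m)%N) (m_le_n : (m <= n)%N)
    (X : 'I_n -> {RV P >-> S}) (X_iid : iid X)
    (h : m.-tuple S -> R) (h_meas : measurable_fun [set: m.-tuple S] h)
    (nu : R) (nu_gt0 : 0 < nu) :
  let Z := fun w : T => h [tuple X (widen_ord m_le_n j) w | j < m] in
  let m_h := fine 'E_P[Z] in
  let U := fun w : T => U_statistic h (fun i : 'I_n => X i w) in
  let k := (n %/ m)%N in
  sub_gaussian P Z (nu ^+ 2) ->
  (forall t : R, 0 < t ->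
     (P [set w | t <= `|U w - m_h|]%R
        <= (2 * expR (- (k%:R * t ^+ 2 / (2 * nu ^+ 2))))%R%:E)%E) /\
  (forall delta : R, 0 < delta < 1 ->
     ((1 - delta)%R%:E
        <= P [set w | `|U w - m_h|
                        <= nu * Num.sqrt (2 * ln (2 / delta) / k%:R)]%R)%E).
Proof.
move=> Z m_h U k [_ Z_mgf].
have k_gt0 : (0 < k)%N by rewrite divn_gt0// (leq_trans _ m_ge2).
have kR_gt0 : 0 < k%:R :> R by rewrite ltr0n.
have mUc : measurable_fun setT (fun w => U w - m_h).
  by apply: measurable_funB => //; exact: measurable_U_statistic.
(* U - m_h has the moment generating function bound of variance proxy
   nu ^+ 2 / k, since k * (l / k) ^+ 2 = l ^+ 2 / k *)
have U_mgf l : ('M_P (fun w => U w - m_h)%R l <=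
    (expR (l ^+ 2 * (nu ^+ 2 / k%:R) / 2))%:E)%E.
  have widen_inj : injective (widen_ord m_le_n).
    by move=> i j /(congr1 val)/= ?; exact: val_inj.
  apply: (le_trans (U_statistic_mgf_le m_h l X_iid widen_inj h_meas k_gt0
    (leq_divM n m))).
  have -> : (expR (l ^+ 2 * (nu ^+ 2 / k%:R) / 2))%:E =
      ((expR ((l / k%:R) ^+ 2 * nu ^+ 2 / 2))%:E ^+ k)%E.
    rewrite -EFin_expe -expRM_natl; congr (expR _)%:E.
    by field; rewrite gt_eqF.
  apply: lee_expe; last exact: Z_mgf.
  by apply: expectation_ge0 => w; exact: expR_ge0.
have tail t : 0 < t -> (P [set w | t <= `|U w - m_h|]%R <=
    (2 * expR (- (k%:R * t ^+ 2 / (2 * nu ^+ 2))))%R%:E)%E.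
  move=> t_gt0.
  have v_gt0 : 0 < nu ^+ 2 / k%:R by rewrite divr_gt0// exprn_gt0.
  apply: (le_trans (sub_gaussian_tail mUc v_gt0 t_gt0 U_mgf)).
  rewrite lee_fin ler_pM2l// ler_expR le_eqVlt; apply/orP; left; apply/eqP.
  by field; rewrite !gt_eqF.
split=> // delta /andP[delta_gt0 delta_lt1].
set t := nu * _.
have ln_gt0 : 0 < ln (2 / delta).
  by rewrite ln_gt0// ltr_pdivlMr// mul1r (lt_trans delta_lt1)// ltr1n.
have arg_gt0 : 0 < 2 * ln (2 / delta) / k%:R by rewrite divr_gt0// mulr_gt0.
have t_gt0 : 0 < t by rewrite mulr_gt0// sqrtr_gt0.
(* t is chosen so that the tail bound equals delta *)
have := tail t t_gt0.
have -> : 2 * expR (- (k%:R * t ^+ 2 / (2 * nu ^+ 2))) = delta.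
  rewrite /t exprMn sqr_sqrtr ?ltW//.
  rewrite (_ : k%:R * _ / _ = ln (2 / delta)); last first.
    by field; rewrite !gt_eqF.
  by rewrite expRN lnK ?posrE ?divr_gt0// invf_div mulrC divfK.
move=> tail_le.
have m_far : measurable [set w | t <= `|U w - m_h|].
  rewrite -[A in measurable A]setTI.
  rewrite (_ : [set w | _] = (fun w => `|U w - m_h|) @^-1` `[t, +oo[).
    by apply: measurableT_comp => //.
  by apply/seteqP; split => w /=; rewrite in_itv/= andbT.
have m_near : measurable [set w | `|U w - m_h| <= t].
  rewrite -[A in measurable A]setTI.
  rewrite (_ : [set w | _] = (fun w => `|U w - m_h|) @^-1` `]-oo, t]).
    by apply: measurableT_comp => //.
  by apply/seteqP; split => w /=; rewrite in_itv/=.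
apply: (@le_trans _ _ (P (~` [set w | t <= `|U w - m_h|]))).
  by rewrite probability_setC// EFinB leeB.
apply: le_measure; rewrite ?inE//; first exact: measurableC.
by move=> w /= /negP; rewrite -ltNge => /ltW.
Qed.
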